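(* Let $(a,b,c)\in\mathbb{R}^3$ satisfy $b\neq 0$ and $ab-c\neq 0$, let $f(x)=\frac{x+a}{bx+c}$ for $x\in\mathbb{R}\setminus\{\hat x\}$ with $\hat x=-\frac{c}{b}$, and let $q\geq 1$ be an integer. (i) If $K_q(a,b,c)\neq 0$, then $\mathrm{Per}_q(f)\setminus \mathrm{Fix}(f)=\emptyset$. (ii) If $K_q(a,b,c)=0$, then any $x\in\mathbb{R}\setminus\mathcal{P}$ is $q$-periodic, i.e. $\mathrm{Per}_q(f)=\mathbb{R}\setminus\mathcal{P}$.
   Context: $f^n$ denotes the $n$-fold iterate of $f$ (with $f^0(x)=x$), defined at $x$ whenever none of $x,f(x),\dots,f^{n-1}(x)$ equals $\hat x$. $\mathcal{P}=\{x\in\mathbb{R}:\ \exists n\in\mathbb{N}\cup\{0\},\ f^n(x)=\hat x\}$. $\mathrm{Fix}(f)=\{x: f(x)=x\}$. $\mathrm{Per}_q(f)$ is the set of all points $x\in\mathbb{R}$ at which $f^q$ is defined and $f^q(x)=x$ (so $q$ is a period, not necessarily the least one). $\alpha=\frac{1+c+\sqrt{(c-1)^2+4ab}}{2}$ and $\beta=\frac{1+c-\sqrt{(c-1)^2+4ab}}{2}$; these are complex conjugate numbers when $(c-1)^2+4ab<0$. $K_q=K_q(a,b,c)=\sum_{j=0}^{q-1}\alpha^{q-j-1}\beta^{j}$ (symmetric in $\alpha,\beta$, hence a real number); e.g. $K_1=1$, $K_2=1+c$, $K_3=1+c+c^2+ab$. *)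

(* Defs.v *)
From mathcomp Require Import all_boot all_order all_algebra.
From mathcomp Require Import complex.
From mathcomp Require Import classical_sets reals.

Set Implicit Arguments.
Unset Strict Implicit.
Unset Printing Implicit Defensive.

Import Order.TTheory GRing.Theory Num.Theory.

Local Open Scope ring_scope.
Local Open Scope classical_set_scope.
Local Open Scope complex_scope.

Definition xhat (R : realType) (b c : R) : R := - (c / b).

(* A partial function on R is encoded as R -> option R; None means that the
   function is not defined at the point. *)
Definition fpart (R : realType) (a b c x : R) : option R :=
  if x == xhat b c then None else Some ((x + a) / (b * x + c)).

(* The value is None as soon as one of x, f(x), ..., f^(n-1)(x) is xhat. *)
Definition fiter (R : realType) (a b c : R) (n : nat) (x : R) : option R :=
  iter n (obind (fpart a b c)) (Some x).

Definition polar_set (R : realType) (a b c : R) : set R :=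
  [set x | exists n : nat, fiter a b c n x = Some (xhat b c)].

Definition Fix (R : realType) (a b c : R) : set R :=
  [set x | fpart a b c x = Some x].

Definition Per (R : realType) (a b c : R) (q : nat) : set R :=
  [set x | fiter a b c q x = Some x].

(* sqrtC of a negative real d is i times the real square root of -d, so alpha
   and beta are complex conjugate when the discriminant is negative. *)
Definition alpha (R : realType) (a b c : R) : R[i] :=
  (1 + c%:C + sqrtC (((c - 1) ^+ 2 + 4 * a * b)%:C)) / 2.

Definition beta (R : realType) (a b c : R) : R[i] :=
  (1 + c%:C - sqrtC (((c - 1) ^+ 2 + 4 * a * b)%:C)) / 2.

(* The sum is taken in R[i]; it is symmetric in alpha and beta, so its value is
   real. *)
Definition K (R : realType) (a b c : R) (q : nat) : R[i] :=
  \sum_(j < q) alpha a b c ^+ (q - j - 1) * beta a b c ^+ j.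

(* Main.v *)
(* The iterates of [f] are read off from the linear orbit
   [(p_n, d_n) = M^n (x, 1)] with [M = ((1, a), (b, c))].  By Cayley-Hamilton
   [p_n - x d_n] satisfies the two-term recurrence whose characteristic roots
   are [alpha] and [beta] and it vanishes at [n = 0], so
   [p_n - x d_n = K_n (p_1 - x d_1)]; hence [f^q x = x] iff [K_q = 0] or
   [f x = x]. *)
Require Import Defs.
From mathcomp Require Import all_boot all_order all_algebra.
From mathcomp Require Import complex.
From mathcomp Require Import classical_sets reals.
From mathcomp Require Import ring.

Set Implicit Arguments.
Unset Strict Implicit.
Unset Printing Implicit Defensive.

Import Order.TTheory GRing.Theory Num.Theory.

Local Open Scope ring_scope.
Local Open Scope classical_set_scope.
Local Open Scope complex_scope.

(** The sum defining [K], over any commutative ring, so that its recurrence is a formal identity in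
    two variables. *)
Definition geom_sum2 (A : comPzRingType) (x y : A) (n : nat) : A :=
  \sum_(j < n) x ^+ (n - j - 1) * y ^+ j.

Lemma geom_sum2S (A : comPzRingType) (x y : A) (n : nat) :
  geom_sum2 x y n.+1 = x * geom_sum2 x y n + y ^+ n.
Proof.
rewrite /geom_sum2 big_ord_recr /= subSnn expr0 mul1r mulr_sumr.
congr (_ + _); apply: eq_bigr => j _.
by rewrite mulrA -exprS -subSn ?subn_gt0 // -subSn // ltnW.
Qed.

Lemma geom_sum2SS (A : comPzRingType) (x y : A) (n : nat) :
  geom_sum2 x y n.+2 =
    (x + y) * geom_sum2 x y n.+1 - x * y * geom_sum2 x y n.
Proof. by rewrite !geom_sum2S exprS; ring. Qed.

Section Homography.

Variables (R : realType) (a b c : R).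

(** This sum and the product below are the trace and determinant of [M]: [alpha] and [beta] are its
    eigenvalues. *)
Lemma alphaDbeta : alpha a b c + beta a b c = (1 + c)%:C.
Proof. by rewrite [RHS]rmorphD rmorph1 /alpha /beta; field. Qed.

Lemma alphaMbeta : alpha a b c * beta a b c = (c - a * b)%:C.
Proof.
rewrite mulrC /alpha /beta mulrACA -subr_sqr sqrtCK.
rewrite !(rmorphD, rmorphM, rmorphN, rmorphXn, rmorph1, rmorph_nat) /=.
by field.
Qed.

Lemma K0 : K a b c 0 = 0. Proof. exact: big_ord0. Qed.

Lemma K1 : K a b c 1 = 1.
Proof. by rewrite /K big_ord1 !expr0 mulr1. Qed.

Lemma KSS n :
  K a b c n.+2 = (1 + c)%:C * K a b c n.+1 - (c - a * b)%:C * K a b c n.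
Proof. by rewrite -alphaDbeta -alphaMbeta; exact: geom_sum2SS. Qed.

(** Homogeneous coordinates of the orbit; unlike [fiter], they are defined for every [n]. *)
Definition hom_orbit (x : R) (n : nat) : R * R :=
  iter n (fun u => (u.1 + a * u.2, b * u.1 + c * u.2)) (x, 1).

Lemma hom_orbit_defect x n :
  ((hom_orbit x n).1 - x * (hom_orbit x n).2)%:C =
    K a b c n * (x + a - x * (b * x + c))%:C.
Proof.
elim/ltn_ind: n => -[|[|n]] IH.
- by rewrite K0 mul0r /= mulr1 subrr.
- by rewrite K1 mul1r /= !mulr1.
(* What remains is the Cayley-Hamilton relation for [M], checked on one orbit vector. *)
rewrite KSS mulrBl -!mulrA -!IH // -!rmorphM -rmorphB; congr (_%:C).
by rewrite /hom_orbit !iterS; case: (iter n _ _) => p d /=; ring.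
Qed.

Lemma fpart_xhat : fpart a b c (xhat b c) = None.
Proof. by rewrite /fpart eqxx. Qed.

Hypothesis b_neq0 : b != 0.

Lemma den_eq0 x : (b * x + c == 0) = (x == xhat b c).
Proof.
rewrite addr_eq0 /xhat -mulNr.
by apply/eqP/eqP => [<-|->]; rewrite mulrC ?mulKf ?mulfVK.
Qed.

Lemma fiterS n x :
  fiter a b c n.+1 x = obind (fpart a b c) (fiter a b c n x).
Proof. by []. Qed.

(** If [f^n x = z], the next denominator is [(b z + c) d_n], which stays nonzero as long as the
    orbit avoids the pole. *)
Lemma fiter_hom_orbit n x y : fiter a b c n x = Some y ->
  (hom_orbit x n).2 != 0 /\ (hom_orbit x n).1 = y * (hom_orbit x n).2.
Proof.
elim: n y => [|n IH] y; first by case=> <-; rewrite /= oner_eq0 mulr1.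
rewrite fiterS; case: fiter IH => //= z /(_ z erefl).
case: (hom_orbit x n) => p d /= [d0 ->].
rewrite /fpart; case: ifPn => //; rewrite -den_eq0 => zN [<-].
rewrite (mulrA b) -!mulrDl; split; first by rewrite mulf_neq0.
by rewrite mulrA mulfVK.
Qed.

Lemma fiterD m n x :
  fiter a b c (m + n) x = obind (fiter a b c m) (fiter a b c n x).
Proof.
rewrite /fiter iterD; case: (iter n _ _) => //=.
by elim: m => //= m ->.
Qed.

Lemma fiter_Per_mul q m x :
  fiter a b c q x = Some x -> fiter a b c (m * q) x = Some x.
Proof. by move=> qx; elim: m => //= m IH; rewrite mulSn fiterD IH. Qed.

(** An orbit reaching the pole at time [n] is undefined from time [n + 1] on, yet periodicity makes
    the iterate of order [q (n + 1) >= n + 1] defined. *)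
Lemma Per_not_polar q : (1 <= q)%N -> Per a b c q `<=` ~` polar_set a b c.
Proof.
move=> q_gt0 x xq [n xn].
have := fiter_Per_mul n.+1 xq.
rewrite -(subnK (leq_pmulr n.+1 q_gt0)) fiterD fiterS xn.
by rewrite [obind _ (Some _)]fpart_xhat.
Qed.

Lemma not_polar_fiter n x :
  ~ polar_set a b c x -> exists y, fiter a b c n x = Some y.
Proof.
move=> xP; elim: n => [|n [y yn]]; first by exists x.
rewrite fiterS yn /= /fpart; case: eqP => [yx|_]; last by eexists.
by case: xP; exists n; rewrite yn yx.
Qed.

Lemma Per_sub_Fix q : (1 <= q)%N -> K a b c q <> 0 ->
  Per a b c q `<=` Fix a b c.
Proof.
move=> q_gt0 Kq x xq.
have xN : x != xhat b c.
  by apply/eqP => xx; apply: (Per_not_polar q_gt0 xq); exists 0%N; rewrite -xx.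
have [_ pq] := fiter_hom_orbit xq.
(* Periodicity makes the defect at [q] vanish; since [K_q] is nonzero, the other factor gives
   [x + a = x (b x + c)], the fixed-point equation. *)
have /esym/eqP := hom_orbit_defect x q.
rewrite pq subrr rmorph0 mulf_eq0 => /orP[/eqP //|].
rewrite fmorph_eq0 subr_eq0 => /eqP xa.
rewrite /Fix /= /fpart (negbTE xN) xa mulfK //.
by rewrite den_eq0.
Qed.

Lemma not_polar_Per q : K a b c q = 0 -> ~` polar_set a b c `<=` Per a b c q.
Proof.
move=> Kq x /(not_polar_fiter q)[y yq].
have [dq pq] := fiter_hom_orbit yq.
(* With [K_q = 0] the defect vanishes, so [y d_q = p_q = x d_q], and [d_q] cancels. *)
have /eqP := hom_orbit_defect x q.
rewrite Kq mul0r fmorph_eq0 pq subr_eq0 => /eqP/(mulIf dq) yx.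
by rewrite /Per /= yq yx.
Qed.

End Homography.

Theorem theorem1 (R : realType) (a b c : R) (q : nat)
  (hb : b != 0) (habc : a * b - c != 0) (hq : (1 <= q)%N) :
  (K a b c q <> 0 -> Per a b c q `\` Fix a b c = set0) /\
  (K a b c q = 0 -> Per a b c q = ~` polar_set a b c).
Proof.
split=> Kq; first by rewrite setD_eq0; exact: Per_sub_Fix.
by apply/seteqP; split; [exact: Per_not_polar | exact: not_polar_Per].
Qed.
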